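(* If $L$ is a TAFL and a Prüfer lattice domain, then $L$ is a ZPI-lattice domain.
   Context: A multiplicative lattice is a set $L$ with a commutative associative multiplication and a partial order $\leq$ such that $(L,\leq)$ is a complete lattice with greatest element $1$ and least element $0$, and such that $1x=x$ and $x(\bigvee E)=\bigvee\{xe\mid e\in E\}$ for all $x\in L$ and $E\subseteq L$. An element $a\in L$ is compact if for each $F\subseteq L$ with $a\leq\bigvee F$ there is a finite $E\subseteq F$ with $a\leq\bigvee E$. A subset is multiplicatively closed if it contains $1$ and is closed under products. $L$ is a C-lattice if there is a multiplicatively closed subset $C\subseteq L$ of compact elements such that every element of $L$ is a join of elements of $C$. For $a,b\in L$, $(a:b)=\bigvee\{x\in L\mid xb\leq a\}$. An element $e\in L$ is principal if $a\wedge be=((a:e)\wedge b)e$ and $((a\vee be):e)=(a:e)\vee b$ for all $a,b\in L$. An element $a$ is proper if $a<1$. A proper element $p$ is prime if for all $a,b\in L$, $ab\leq p$ implies $a\leq p$ or $b\leq p$. $L$ is a lattice domain if $0$ is a prime element. $L$ is a Prüfer lattice if every compact element of $L$ is principal; a Prüfer lattice domain is a Prüfer lattice that is a lattice domain. A proper element $p$ is a TA-element ($2$-absorbing element) if for all $a,b,c\in L$, $abc\leq p$ implies $ab\leq p$ or $bc\leq p$ or $ac\leq p$. A TAFL is a C-lattice in which every element is a finite product of TA-elements (the element $1$ being the empty product). A ZPI-lattice is a multiplicative lattice in which every element is a finite product of prime elements (the element $1$ being the empty product); a ZPI-lattice domain is a ZPI-lattice that is a lattice domain. *)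

(* Defs.v *)
From HB Require Import structures.
From mathcomp Require Import all_boot all_order.
From mathcomp Require Import boolp classical_sets cardinality.

Set Implicit Arguments.
Unset Strict Implicit.
Unset Printing Implicit Defensive.

Import Order.TTheory.

Local Open Scope classical_set_scope.
Local Open Scope order_scope.

Declare Scope mlattice_scope.
Delimit Scope mlattice_scope with ML.

HB.mixin Record TBLattice_isComplete d T of Order.TBLattice d T := {
  supremums_nonempty : forall E : set T, supremums E !=set0;
  infimums_nonempty : forall E : set T, infimums E !=set0
}.

#[short(type="completeLatticeType")]
HB.structure Definition CompleteLattice d :=
  {T of Order.TBLattice d T & TBLattice_isComplete d T}.

(* The default value of supremum is only used for the empty set, whose join
   is \bot; on a complete lattice this is therefore the join of E. *)
Definition bigjoin d (L : completeLatticeType d) (E : set L) : L :=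
  supremum \bot E.

HB.mixin Record CompleteLattice_isMultiplicative d T
    of CompleteLattice d T := {
  mulL : T -> T -> T;
  mulLC : commutative mulL;
  mulLA : associative mulL;
  mul1L : left_id (\top : T) mulL;
  mulL_bigjoin : forall (x : T) (E : set T),
    mulL x (bigjoin E) = bigjoin [set mulL x e | e in E]
}.

#[short(type="multLatticeType")]
HB.structure Definition MultLattice d :=
  {T of CompleteLattice d T & CompleteLattice_isMultiplicative d T}.

Notation "x * y" := (mulL x y) : mlattice_scope.
Local Open Scope mlattice_scope.

Section MultLatticeNotions.
Context {d : Order.disp_t} {L : multLatticeType d}.
Implicit Types (a b c e p x : L) (C E F : set L).

Definition compact_elt a : Prop :=
  forall F, a <= bigjoin F ->
    exists E, [/\ finite_set E, E `<=` F & a <= bigjoin E].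

Definition mult_closed C : Prop :=
  C \top /\ forall a b, C a -> C b -> C (a * b).

Definition residual a b : L := bigjoin [set x | x * b <= a].

Definition principal_elt e : Prop := forall a b,
  a `&` (b * e) = (residual a e `&` b) * e /\
  residual (a `|` (b * e)) e = residual a e `|` b.

Definition proper_elt a : Prop := a < \top.

Definition prime_elt p : Prop :=
  proper_elt p /\ forall a b, a * b <= p -> a <= p \/ b <= p.

Definition TA_elt p : Prop :=
  proper_elt p /\
  forall a b c, a * b * c <= p -> [\/ a * b <= p, b * c <= p | a * c <= p].

Definition finite_product_of (P : L -> Prop) x : Prop :=
  exists s : seq L, (forall y, y \in s -> P y) /\ x = \big[mulL / \top]_(y <- s) y.

End MultLatticeNotions.

Definition C_lattice d (L : multLatticeType d) : Prop :=
  exists C : set L, [/\ mult_closed C, forall c, C c -> compact_elt c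
    & forall x : L, exists E : set L, E `<=` C /\ x = bigjoin E].

Definition lattice_domain d (L : multLatticeType d) : Prop :=
  prime_elt (\bot : L).

Definition Prufer_lattice d (L : multLatticeType d) : Prop :=
  forall x : L, compact_elt x -> principal_elt x.

Definition Prufer_lattice_domain d (L : multLatticeType d) : Prop :=
  Prufer_lattice L /\ lattice_domain L.

Definition TAFL d (L : multLatticeType d) : Prop :=
  C_lattice L /\ forall x : L, finite_product_of TA_elt x.

Definition ZPI_lattice d (L : multLatticeType d) : Prop :=
  forall x : L, finite_product_of prime_elt x.

Definition ZPI_lattice_domain d (L : multLatticeType d) : Prop :=
  ZPI_lattice L /\ lattice_domain L.

(* Main.v *)
(** In a Prüfer lattice domain every TA-element [q] is a product of at most two
    primes, so a factorization into TA-elements refines to one into primes.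
    Let [r] be the radical of [q]; it is itself a TA-element and [r * r <= q <= r].
    If [r] is prime and [q <> r], then [q] is [r]-primary and equals [r * r].
    If [r] is not prime, say [a * b <= r] with [a], [b] compact and not below [r],
    then [(r : a)] and [(r : b)] are comaximal primes with product [q].
    The property of Prüfer domains behind both cases is that
    [(a : b) `|` (b : a) = \top] for all compact [a] and [b]; it stands in for
    localization. *)
From HB Require Import structures.
Require Import Defs.
From mathcomp Require Import all_boot all_order.
From mathcomp Require Import boolp classical_sets cardinality.

Set Implicit Arguments.
Unset Strict Implicit.
Unset Printing Implicit Defensive.

Import Order.TTheory.

Local Open Scope classical_set_scope.
Local Open Scope order_scope.
Local Open Scope mlattice_scope.

HB.instance Definition _ d (L : multLatticeType d) :=
  Monoid.isComLaw.Build L \top mulL (@mulLA d L) (@mulLC d L) (@mul1L d L).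

(** * Joins, residuals, compact elements and finite products *)

Section MultLatticeTheory.
Context {d : Order.disp_t} {L : multLatticeType d}.
Implicit Types (a b c e p q r x y z : L) (E F : set L).

Lemma bigjoin_ub E x : E x -> x <= bigjoin E.
Proof.
move=> Ex; rewrite /bigjoin /supremum; case: ifPn => [/eqP E0|_].
  by move: Ex; rewrite E0.
by case: xgetP => [z _ [ubz _]|nE]; [exact: ubz | have [z /nE] := supremums_nonempty E].
Qed.

Lemma bigjoin_le E y : (forall x, E x -> x <= y) -> bigjoin E <= y.
Proof.
move=> Ey; rewrite /bigjoin /supremum; case: ifPn => [_|_]; first exact: le0x.
case: xgetP => [z _ [_ lz]|_]; last exact: le0x.
by apply: lz => x /Ey.
Qed.

Lemma bigjoin_pair x y : bigjoin [set x; y] = x `|` y.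
Proof.
apply/eqP; rewrite eq_le leUx !bigjoin_ub ?andbT; [|by right|by left].
by apply: bigjoin_le => z [->|->]; rewrite ?leUl ?leUr.
Qed.

Lemma mulLx1 x : x * \top = x.
Proof. by rewrite mulLC mul1L. Qed.

Lemma mulLUr x y z : x * (y `|` z) = x * y `|` x * z.
Proof. by rewrite -!bigjoin_pair mulL_bigjoin image_setU !image_set1. Qed.

Lemma mulLUl x y z : (y `|` z) * x = y * x `|` z * x.
Proof. by rewrite mulLC mulLUr !(mulLC x). Qed.

Lemma leL_mull x y z : y <= z -> x * y <= x * z.
Proof. by move=> /join_idPl yz; rewrite -yz mulLUr leUr. Qed.

Lemma leL_mul x y z t : x <= y -> z <= t -> x * z <= y * t.
Proof.
move=> xy zt; apply: le_trans (leL_mull _ zt) _.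
by rewrite !(mulLC _ t) leL_mull.
Qed.

Lemma mulL_lel x y : x * y <= x.
Proof. by rewrite -[leRHS]mulLx1 leL_mull ?lex1. Qed.

Lemma mulL_ler x y : x * y <= y.
Proof. by rewrite mulLC mulL_lel. Qed.

Lemma mulL_bigjoin_le x E y :
  (forall e, E e -> x * e <= y) -> x * bigjoin E <= y.
Proof.
by move=> Ey; rewrite mulL_bigjoin; apply: bigjoin_le => _ [e Ee <-]; exact: Ey.
Qed.

(** Multiplication by [b] preserves joins, so the join defining the residual itself satisfies the
    defining inequality; this is the adjunction behind all later uses of residuals. *)
Lemma le_residual a b x : (x <= residual a b) = (x * b <= a).
Proof.
apply/idP/idP => [xab|]; last exact: bigjoin_ub.
apply: le_trans (leL_mul xab (lexx b)) _; rewrite mulLC.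
by apply: mulL_bigjoin_le => e /=; rewrite mulLC.
Qed.

Lemma residual_mul_le a b : residual a b * b <= a.
Proof. by rewrite -le_residual. Qed.

Lemma top_residual a b : (residual a b == \top) = (b <= a).
Proof. by rewrite -le1x le_residual mul1L. Qed.

Lemma prime_mulP p x y : prime_elt p -> x * y <= p -> ~~ (x <= p) -> y <= p.
Proof. by move=> [_ pp] /pp[->|]. Qed.

(** As for comaximal ideals: multiply the meet by [x]|[y] and bound it by the other element in each
    summand. *)
Lemma comaximal_meet_le_mul x y : x `|` y = \top -> x `&` y <= x * y.
Proof.
move=> xy; rewrite -[leLHS]mulLx1 -xy mulLUr leUx.
by rewrite [in X in X && _]mulLC !leL_mul ?leIl ?leIr.
Qed.

Lemma compact_join a b : compact_elt a -> compact_elt b -> compact_elt (a `|` b).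
Proof.
move=> ca cb F; rewrite leUx => /andP[/ca[E [fE EF aE]] /cb[E' [fE' EF' bE']]].
exists (E `|` E')%classic; split; first by rewrite finite_setU.
- by move=> x [/EF|/EF'].
- rewrite leUx; apply/andP; split.
  + by apply: le_trans aE _; apply: bigjoin_le => x Ex; apply: bigjoin_ub; left.
  + by apply: le_trans bE' _; apply: bigjoin_le => x Ex; apply: bigjoin_ub; right.
Qed.

Lemma le_compact x y : C_lattice L ->
  (forall c, compact_elt c -> c <= x -> c <= y) -> x <= y.
Proof.
move=> [C [_ Ccompact Cjoin]] xy; have [E [EC xE]] := Cjoin x.
rewrite xE; apply: bigjoin_le => c Ec; apply: xy; first exact/Ccompact/EC.
by rewrite xE; exact: bigjoin_ub.
Qed.

Lemma compact_notle x y : C_lattice L -> ~~ (x <= y) ->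
  exists c, [/\ compact_elt c, c <= x & ~~ (c <= y)].
Proof.
move=> LC xy; apply: contrapT => noc; case/negP: xy.
apply: le_compact => // c cc cx; apply: contrapT => /negP cy.
by apply: noc; exists c.
Qed.

Lemma finite_product_mul (P : L -> Prop) x y :
  finite_product_of P x -> finite_product_of P y -> finite_product_of P (x * y).
Proof.
move=> [s [Ps ->]] [t [Pt ->]]; exists (s ++ t); split; last by rewrite big_cat.
by move=> z; rewrite mem_cat => /orP[/Ps|/Pt].
Qed.

Lemma finite_product1 (P : L -> Prop) x : P x -> finite_product_of P x.
Proof.
move=> Px; exists [:: x]; split; last by rewrite big_seq1.
by move=> y; rewrite inE => /eqP ->.
Qed.

Lemma finite_product_trans (P Q : L -> Prop) x :
  (forall y, P y -> finite_product_of Q y) ->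
  finite_product_of P x -> finite_product_of Q x.
Proof.
move=> PQ [s [Ps ->]]; rewrite big_seq.
apply: (big_ind (finite_product_of Q)); last by move=> y /Ps/PQ.
- by exists [::]; rewrite big_nil.
- exact: finite_product_mul.
Qed.

End MultLatticeTheory.

(** * The radical of a TA-element *)

Section TARadical.
Context {d : Order.disp_t} {L : multLatticeType d}.
Implicit Types (a b x y z p q r : L).

(* For a TA-element, [x ^ n <= q] already forces [x ^ 2 <= q], so this is the
   usual radical of [q]. *)
Definition TA_radical q : L := bigjoin [set x | x * x <= q].

(** The TA-property is applied to [x], [y] and [x]|[y]: each of its three alternatives bounds
    [x * y]. *)
Lemma TA_mul_of_sqr q x y : TA_elt q -> x * x <= q -> y * y <= q -> x * y <= q.
Proof.
move=> [_ qTA] xx yy; have: x * y * (x `|` y) <= q.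
  rewrite mulLUr leUx (Monoid.mulmAC mulL x y x) -(mulLA x y y).
  by rewrite (le_trans (mulL_lel _ _) xx) (le_trans (mulL_ler _ _) yy).
by case/qTA => //; rewrite mulLUr leUx => /andP[] //; rewrite mulLC.
Qed.

Lemma TA_radical_sqr_le q : TA_elt q -> TA_radical q * TA_radical q <= q.
Proof.
move=> qTA; apply: mulL_bigjoin_le => x xx; rewrite mulLC.
by apply: mulL_bigjoin_le => y yy; exact: TA_mul_of_sqr.
Qed.

Lemma le_TA_radical q x : TA_elt q -> (x <= TA_radical q) = (x * x <= q).
Proof.
move=> qTA; apply/idP/idP => [xr|]; last exact: bigjoin_ub.
exact: le_trans (leL_mul xr xr) (TA_radical_sqr_le qTA).
Qed.

Lemma TA_le_radical q : TA_elt q -> q <= TA_radical q.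
Proof. by move=> qTA; rewrite le_TA_radical // mulL_lel. Qed.

Lemma TA_radical_semiprime q x :
  TA_elt q -> x * x <= TA_radical q -> x <= TA_radical q.
Proof.
move=> qTA; rewrite !le_TA_radical //.
by have [_ qTA'] := qTA; rewrite mulLA => /qTA'[] // /qTA'[].
Qed.

(** Being below the radical is tested on squares, so the TA-property of [q] is applied to [a * a],
    [b * b] and [c * c]. *)
Lemma TA_radical_TA q : TA_elt q -> TA_elt (TA_radical q).
Proof.
move=> qTA; split.
  rewrite /proper_elt lt_neqAle lex1 andbT -le1x le_TA_radical // mul1L le1x.
  by have [qp _] := qTA; rewrite lt_eqF.
move=> a b c; rewrite !le_TA_radical //.
rewrite (Monoid.mulmACA mulL (a * b)) (Monoid.mulmACA mulL a b a).
rewrite (Monoid.mulmACA mulL b) (Monoid.mulmACA mulL a c).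
by rewrite (Monoid.mulmACA mulL a b); have [_ qTA'] := qTA; exact: qTA'.
Qed.

End TARadical.

(** * Residuals of a semiprime TA-element that is not prime *)

Section NonprimeSemiprime.
Context {d : Order.disp_t} {L : multLatticeType d}.
Variables (r a b : L).
Hypotheses (rTA : TA_elt r) (rsemi : forall x, x * x <= r -> x <= r).
Hypotheses (ab : a * b <= r) (ar : ~~ (a <= r)) (br : ~~ (b <= r)).

Lemma semiprime_TA_residual_prime : prime_elt (residual r a).
Proof.
split.
  by rewrite /proper_elt lt_neqAle lex1 andbT top_residual.
move=> x y; rewrite !le_residual => xya.
(* Adding [b] to both factors rules out the third alternative. *)
have: (x `|` b) * (y `|` b) * a <= r.
  have le_b z : z * b * a <= r.
    by rewrite -mulLA (mulLC b) (le_trans (mulL_ler _ _) ab).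
  by rewrite mulLUr !mulLUl !leUx xya (mulLC b y) !le_b.
have [_ rTA'] := rTA.
case/rTA'.
- move=> h; case/negP: br; apply: rsemi; apply: le_trans h.
  by apply: leL_mul; rewrite leUr.
- by move=> h; right; apply: le_trans h; rewrite leL_mul ?leUl.
- by move=> h; left; apply: le_trans h; rewrite leL_mul ?leUl.
Qed.

(** The factors are enlarged so that the two unwanted alternatives would give [a * a <= r] or
    [b * b <= r]. *)
Lemma semiprime_TA_mul_le x y : x * a <= r -> y * b <= r -> x * y <= r.
Proof.
move=> xa yb; have: (x `|` b) * (y `|` a) * (a `|` b) <= r.
  have le_r s t u : s * t <= r -> s * t * u <= r by exact/le_trans/mulL_lel.
  rewrite !(mulLUl, mulLUr) !leUx.
  rewrite (Monoid.mulmAC mulL x y a) (mulLC b y) (mulLC b a) -(mulLA x y b).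
  by rewrite (mulLC x (y * b)) !le_r.
have [_ rTA'] := rTA.
case/rTA' => h.
- by apply: le_trans h; rewrite leL_mul ?leUl.
- case/negP: ar; apply: rsemi; apply: le_trans h.
  by rewrite leL_mul ?leUl ?leUr.
- case/negP: br; apply: rsemi; apply: le_trans h.
  by rewrite leL_mul ?leUl ?leUr.
Qed.

End NonprimeSemiprime.

(** * Factoring TA-elements in a Prüfer lattice domain *)

Section PruferLatticeDomain.
Context {d : Order.disp_t} {L : multLatticeType d}.
Hypotheses (LC : C_lattice L) (LP : Prufer_lattice_domain L).
Implicit Types (a b x y z p q r : L).

Lemma compact_mul_residual x z : compact_elt z -> x <= z -> residual x z * z = x.
Proof.
move=> /LP.1 /(_ x \top)[+ _] xz.
by rewrite mul1L meetx1 (meet_idPl xz) => <-.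
Qed.

(** The second identity for principal [e], taken at [\bot], reads [(x * e : e) = (\bot : e)]|[x],
    and [(\bot : e) = \bot] because [\bot] is prime. *)
Lemma compact_cancel e x : compact_elt e -> e != \bot -> e <= x * e -> x = \top.
Proof.
move=> /LP.1 /(_ \bot x)[_ +] e0 exe; rewrite join0x.
have -> : residual \bot e = \bot.
  apply/eqP; rewrite -lex0; have [_ pr] := LP.2.
  by case: (pr _ _ (residual_mul_le \bot e)) => //; rewrite !lex0 (negPf e0).
rewrite join0x => <-; apply/eqP.
by rewrite top_residual.
Qed.

(** With [e = a]|[b], the join of [(a : e)] and [(b : e)] fixes [e] under multiplication, so it is
    [\top] by cancellation if [e != \bot]; these residuals lie below [(a : b)] and [(b : a)]. *)
Lemma compact_residual_comaximal a b : compact_elt a -> compact_elt b ->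
  residual a b `|` residual b a = \top.
Proof.
move=> ca cb; set e := a `|` b; have ce : compact_elt e by exact: compact_join.
have [e0|e0] := eqVneq e \bot.
  have /eqP -> : residual a b == \top.
    by rewrite top_residual (le_trans (leUr b a)) // -/e e0 le0x.
  by rewrite join1x.
have res_mono x y : y <= e -> residual x e <= residual x y.
  move=> ye; rewrite le_residual.
  exact: le_trans (leL_mull _ ye) (residual_mul_le x e).
apply/eqP; rewrite -le1x -[leLHS](@compact_cancel e (residual a e `|` residual b e)) //.
  by rewrite leU2 // res_mono ?leUl ?leUr.
by rewrite mulLUl !compact_mul_residual ?leUl ?leUr.
Qed.

Lemma TA_primary q x z : TA_elt q -> prime_elt (TA_radical q) ->
  compact_elt x -> compact_elt z ->
  x <= TA_radical q -> ~~ (z <= TA_radical q) -> x * z <= q -> x <= q.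
Proof.
set r := TA_radical q => qTA rp cx cz xr zr xzq.
(* [(x : z) * z <= x <= r] with [r] prime puts [(x : z)] below [r], so this product is below
   [r * r]. *)
have ux : residual x z * x <= q.
  apply: le_trans (TA_radical_sqr_le qTA); rewrite leL_mul //.
  apply: (@prime_mulP _ _ _ z) => //; rewrite mulLC.
  exact: le_trans (residual_mul_le _ _) xr.
(* The other summand [v x], [v = (z : x)], is a multiple of [z], so that the
   TA-property applies to [w z z]. *)
have vx : residual z x * x <= q.
  have wz := compact_mul_residual cz (residual_mul_le z x).
  set w := residual _ z in wz; have [_ qTA'] := qTA.
  have: w * z * z <= q.
    by rewrite wz -mulLA (le_trans (mulL_ler _ _) xzq).
  case/qTA'; rewrite ?wz //.
  by rewrite -le_TA_radical // (negPf zr).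
rewrite -[x]mul1L -(compact_residual_comaximal cx cz) mulLUl leUx ux.
by rewrite vx.
Qed.

(** Fix a compact [x <= r] not below [q]. A compact [y <= q] is the join of [(x : y) * y] and
    [(y : x) * y], and primariness of [q] relative to [x] bounds both by [r * r]. *)
Lemma TA_eq_sqr_radical q : TA_elt q -> prime_elt (TA_radical q) ->
  q != TA_radical q -> q = TA_radical q * TA_radical q.
Proof.
set r := TA_radical q => qTA rp qr.
apply/eqP; rewrite eq_le TA_radical_sqr_le // andbT.
have /(compact_notle LC)[x [cx xr xq]] : ~~ (r <= q).
  by apply: contra qr => rq; rewrite eq_le rq TA_le_radical.
have primary z : z * x <= q -> z <= r.
  move=> zxq; apply: contrapT => /negP /(compact_notle LC)[c [cc cz cr]].
  case/negP: xq; apply: (TA_primary qTA rp cx cc) => //.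
  by rewrite mulLC (le_trans _ zxq) // leL_mul.
apply: (le_compact LC) => y cy yq.
rewrite -[y]mul1L -(compact_residual_comaximal cx cy) mulLUl leUx; apply/andP; split.
(* This summand lies below [x], hence equals some [z * x]; as it is also below [q], [z <= r]. *)
- rewrite -(compact_mul_residual cx (residual_mul_le x y)) leL_mul //.
  apply: primary; rewrite compact_mul_residual ?residual_mul_le //.
  exact: le_trans (mulL_ler _ _) yq.
- rewrite leL_mul ?(le_trans yq (TA_le_radical qTA)) //.
  by apply: primary; exact: le_trans (residual_mul_le _ _) yq.
Qed.

Lemma TA_nonprime_radical q : TA_elt q -> ~ prime_elt (TA_radical q) ->
  exists p1 p2, [/\ prime_elt p1, prime_elt p2 & q = p1 * p2].
Proof.
set r := TA_radical q => qTA rnp.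
have rTA : TA_elt r := TA_radical_TA qTA.
have rsemi x : x * x <= r -> x <= r by exact: TA_radical_semiprime.
(* Compact witnesses are chosen so that their mutual residuals are comaximal. *)
have [a [b [ca cb ab ar br]]] : exists a b,
    [/\ compact_elt a, compact_elt b, a * b <= r, ~~ (a <= r) & ~~ (b <= r)].
  apply: contrapT => nab; apply: rnp; split; first by case: rTA.
  move=> x y xy; apply: contrapT => /not_orP[/negP xr /negP yr]; apply: nab.
  have [a [ca ax ar]] := compact_notle LC xr.
  have [b [cb bY br]] := compact_notle LC yr.
  by exists a, b; split=> //; exact: le_trans (leL_mul ax bY) xy.
have ba : b * a <= r by rewrite mulLC.
set p1 := residual r a; set p2 := residual r b.
have p1P : prime_elt p1 by exact: (@semiprime_TA_residual_prime _ _ _ _ b).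
have p2P : prime_elt p2 by exact: (@semiprime_TA_residual_prime _ _ _ _ a).
have ap2 : a <= p2 by rewrite le_residual.
have bp1 : b <= p1 by rewrite le_residual.
have p12r : p1 * p2 <= r.
  by apply: (semiprime_TA_mul_le rTA rsemi ab ar br); exact: residual_mul_le.
(* [(b : a) <= p1], since [(b : a) * a <= b <= p1] while [a] is not below the prime [p1];
   symmetrically [(a : b) <= p2]. *)
have p12 : p1 `|` p2 = \top.
  apply/eqP; rewrite -le1x -(compact_residual_comaximal ca cb) joinC leU2 //.
    apply: (@prime_mulP _ _ _ a) => //.
      by rewrite mulLC (le_trans (residual_mul_le _ _)).
    by apply: contra ar => ap1; apply: rsemi; rewrite -le_residual.
  apply: (@prime_mulP _ _ _ b) => //.
    by rewrite mulLC (le_trans (residual_mul_le _ _)).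
  by apply: contra br => bp2; apply: rsemi; rewrite -le_residual.
exists p1, p2; split=> //; apply/eqP; rewrite eq_le; apply/andP; split.
  apply: le_trans (comaximal_meet_le_mul p12); apply: le_trans (TA_le_radical qTA) _.
  by rewrite lexI !le_residual !mulL_lel.
have p1r : ~~ (p1 <= r) by apply: contra br; exact: le_trans.
have p2r : ~~ (p2 <= r) by apply: contra ar; exact: le_trans.
have [_ qTA'] := qTA.
(* The TA-property then removes one repeated factor at a time: [p1 * p1 <= q] or [p2 * p2 <= q]
   would put [p1] or [p2] below [r]. *)
have: (p1 * p1) * p2 * p2 <= q.
  by rewrite -mulLA Monoid.mulmACA -le_TA_radical.
have p112 : p1 * p1 * p2 <= q -> p1 * p2 <= q.
  by case/qTA' => //; rewrite -le_TA_radical // (negPf p1r).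
by case/qTA' => //; rewrite -le_TA_radical // (negPf p2r).
Qed.

Lemma TA_finite_product_prime q : TA_elt q -> finite_product_of prime_elt q.
Proof.
move=> qTA; have [rp|rnp] := pselect (prime_elt (TA_radical q)).
  have [->|qr] := eqVneq q (TA_radical q); first exact: finite_product1.
  rewrite (TA_eq_sqr_radical qTA rp qr).
  by apply: finite_product_mul; exact: finite_product1.
have [p1 [p2 [p1P p2P ->]]] := TA_nonprime_radical qTA rnp.
by apply: finite_product_mul; exact: finite_product1.
Qed.

End PruferLatticeDomain.

Theorem theorem3p5 (d : Order.disp_t) (L : multLatticeType d)
    (hTAFL : TAFL L) (hPrufer : Prufer_lattice_domain L) :
  ZPI_lattice_domain L.
Proof.
have [LC TAfact] := hTAFL; split; last by case: hPrufer.
move=> x; apply: finite_product_trans (TAfact x).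
exact: TA_finite_product_prime.
Qed.
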